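(* For every integer $n\ge2$, the Higman–Thompson group $V_n$ is generated by four involutions.
   Context: For $n\ge2$ let $n^*$ be the set of finite words over $\{0,\dots,n-1\}$ (the rooted $n$-ary tree). Let $\mathfrak T_n$ be the set of finite rooted subtrees $\tau\subseteq n^*$ closed under prefixes, containing the empty word, and such that for each word $\alpha$, either all or none of $\alpha0,\dots,\alpha(n-1)$ lie in $\tau$; $\mathrm{Lea}(\tau)$ is its set of leaves. For $\tau_0,\tau_1\in\mathfrak T_n$ with the same number of leaves, a bijection $b\colon\mathrm{Lea}(\tau_0)\to\mathrm{Lea}(\tau_1)$ induces the bijection $\alpha\gamma\mapsto b(\alpha)\gamma$ between cofinite subsets of $n^*$. $V_n$ is the group of such bijections modulo equality on a cofinite subset of $n^*$, under composition (this is Higman's $G_{n,1}$; $V_2$ is Thompson's group $V$). *)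

(* Defs.v *)
From mathcomp Require Import all_boot.
Set Implicit Arguments. Unset Strict Implicit. Unset Printing Implicit Defensive.

Definition word (n : nat) := seq 'I_n.

Definition is_tree (n : nat) (tau : seq (word n)) : Prop :=
  [::] \in tau /\
  (forall (alpha : word n) (k : nat), alpha \in tau -> take k alpha \in tau) /\
  (forall alpha : word n,
     [forall i : 'I_n, rcons alpha i \in tau] ||
     [forall i : 'I_n, rcons alpha i \notin tau]).

Definition leaves (n : nat) (tau : seq (word n)) : seq (word n) :=
  undup [seq alpha <- tau | ~~ [exists i : 'I_n, rcons alpha i \in tau]].

(* Partial bijection of n^* (defined on a cofinite set):
   alpha gamma |-> b(alpha) gamma for alpha a leaf of tau0. *)
Definition induced (n : nat) (tau0 : seq (word n)) (b : word n -> word n)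
  (w : word n) : option (word n) :=
  match [seq alpha <- leaves tau0 | prefix alpha w] with
  | alpha :: _ => Some (b alpha ++ drop (size alpha) w)
  | [::] => None
  end.

(* Representatives of elements of V_n: maps induced by a bijection
   b : Lea(tau0) -> Lea(tau1) between leaves of two trees in T_n. *)
Definition is_Vn (n : nat) (f : word n -> option (word n)) : Prop :=
  exists (tau0 tau1 : seq (word n)) (b : word n -> word n),
    is_tree tau0 /\ is_tree tau1 /\
    perm_eq [seq b alpha | alpha <- leaves tau0] (leaves tau1) /\
    (forall w, f w = induced tau0 b w).

Definition Veq (n : nat) (f g : word n -> option (word n)) : Prop :=
  exists L : seq (word n), forall w, w \notin L -> f w = g w.

Definition Vcomp (n : nat) (f g : word n -> option (word n)) : word n -> option (word n) :=
  fun w => obind f (g w).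
Definition Vid (n : nat) : word n -> option (word n) := fun w => Some w.

Definition Vprod (n : nat) (s : seq (word n -> option (word n))) : word n -> option (word n) :=
  foldr (@Vcomp n) (@Vid n) s.

Definition Vinvolution (n : nat) (a : word n -> option (word n)) : Prop :=
  is_Vn a /\ ~ Veq a (@Vid n) /\ Veq (Vcomp a a) (@Vid n).

Fixpoint all_among4 (n : nat) (a b c d : word n -> option (word n))
  (s : seq (word n -> option (word n))) : Prop :=
  match s with
  | [::] => True
  | x :: s' => (x = a \/ x = b \/ x = c \/ x = d) /\ all_among4 a b c d s'
  end.

(* Main.v *)
(* Let (u v) denote the swap of the cones below two incomparable words. The swaps
   generate V_n: if a bijection from the leaves of one tree to the leaves of another
   is composed with a swap so that all children of some x go to the corresponding
   children of some y, then both carets can be removed, and a permutation of the leaves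
   of one tree is a product of swaps.

   Three involutions generate the symmetric group on the two-letter words: two
   reflections of a cycle and a transposition of neighbours. The fourth generator is
   (00 1), where 1 stands for the last letter. It conjugates (1i 01) to (00i 01).
   Conjugating by permutations of two-letter words gives all (xi y) with x, y distinct
   two-letter words. With a third two-letter word z, the swap (xw z) conjugates (zi y)
   to (xwi y), so all (xw y) are obtained, and then all (u v) with u and v of length at
   least two. A shorter swap (u v) is the product of the (ui vi) outside {u, v}. *)

Require Import Defs.
From mathcomp Require Import all_boot zify.

Set Implicit Arguments. Unset Strict Implicit. Unset Printing Implicit Defensive.

(** * Incomparable words and swaps of cones *)

Section Swap.
Variable T : eqType.
Implicit Types (u v w x y : seq T).

Definition incomparable u v := ~~ prefix u v && ~~ prefix v u.

Lemma incomparable_sym u v : incomparable u v = incomparable v u.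
Proof. by rewrite /incomparable andbC. Qed.

Lemma drop_size_catl u w : drop (size u) (u ++ w) = w.
Proof. by rewrite drop_size_cat. Qed.

Lemma prefix_comparable u v w : prefix u w -> prefix v w -> prefix u v || prefix v u.
Proof.
move=> /prefixP[s ->]; elim: u v => [|a u IH] [|b v] //=.
by case: eqP => // -> /IH; rewrite eqxx.
Qed.

Lemma incomparable_cat u v w : incomparable u v -> prefix u (v ++ w) = false.
Proof.
case/andP=> uv vu; apply/negP=> uw.
by have := prefix_comparable uw (prefix_prefix v w); rewrite (negPf uv) (negPf vu).
Qed.

Lemma incomparable_catlr u v w x :
  incomparable u v -> incomparable (u ++ w) (v ++ x).
Proof.
move=> uv; rewrite /incomparable; apply/andP; split; apply/negP=> /catl_prefix.
  by rewrite incomparable_cat.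
by rewrite incomparable_cat // incomparable_sym.
Qed.

Lemma incomparable_rcons u v a b :
  incomparable u v -> incomparable (rcons u a) (rcons v b).
Proof. by rewrite -!cats1; apply: incomparable_catlr. Qed.

Lemma incomparable_size u v : size u = size v -> u != v -> incomparable u v.
Proof.
move=> E uv; rewrite /incomparable !prefixE {1}E -{2}E !take_size.
by rewrite (eq_sym v) uv.
Qed.

Lemma incomparable_neq u v : incomparable u v -> u != v.
Proof. by apply: contraTN => /eqP->; rewrite /incomparable prefix_refl. Qed.

Definition antichain (C : seq (seq T)) :=
  {in C &, forall x y, x != y -> incomparable x y}.

(* A total map on finite words: it is a genuine involution of n^*, so conjugation
   identities between swaps hold at every word and not just outside a finite set. *)
Definition swap u v w :=
  if prefix u w then v ++ drop (size u) w
  else if prefix v w then u ++ drop (size v) w else w.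

Lemma swapl u v w : swap u v (u ++ w) = v ++ w.
Proof. by rewrite /swap prefix_prefix drop_size_catl. Qed.

Lemma swapr u v w : incomparable u v -> swap u v (v ++ w) = u ++ w.
Proof.
by move=> uv; rewrite /swap incomparable_cat // prefix_prefix drop_size_catl.
Qed.

Lemma swap_out u v x w :
  incomparable u x -> incomparable v x -> swap u v (x ++ w) = x ++ w.
Proof. by move=> ux vx; rewrite /swap !incomparable_cat. Qed.

Lemma swapxx u w : swap u u w = w.
Proof. by rewrite /swap; case: ifP => [/prefixP[s ->]|->] //; rewrite drop_size_catl. Qed.

Lemma swap_left u v : swap u v u = v.
Proof. by have := swapl u v [::]; rewrite !cats0. Qed.

Lemma swap_right u v : incomparable u v -> swap u v v = u.
Proof. by move=> uv; have := swapr [::] uv; rewrite !cats0. Qed.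

Lemma swap_fix u v x : incomparable u x -> incomparable v x -> swap u v x = x.
Proof. by move=> ux vx; have := swap_out [::] ux vx; rewrite !cats0. Qed.

Lemma swapK u v : incomparable u v -> involutive (swap u v).
Proof.
move=> uv w; rewrite {2}/swap; case: ifP => [/prefixP[s ->]|Nu].
  by rewrite drop_size_catl swapr.
case: ifP => [/prefixP[s ->]|Nv]; first by rewrite drop_size_catl swapl.
by rewrite /swap Nu Nv.
Qed.

(** If [w] lies in neither target cone, then [g w] lies in neither source cone, because [f] carries
    source cones onto target cones; both sides then fix [w]. *)
Lemma swap_conj (f g : seq T -> seq T) u v u' v' :
  cancel g f -> (forall w, f (u ++ w) = u' ++ w) ->
  (forall w, f (v ++ w) = v' ++ w) -> cancel f g ->
  incomparable u v -> incomparable u' v' ->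
  forall w, swap u' v' w = f (swap u v (g w)).
Proof.
move=> gK fu fv fK uv uv' w.
have gu s : g (u' ++ s) = u ++ s by rewrite -fu fK.
have gv s : g (v' ++ s) = v ++ s by rewrite -fv fK.
have [/prefixP[s ->]|Nu] := boolP (prefix u' w); first by rewrite gu !swapl fv.
have [/prefixP[s ->]|Nv] := boolP (prefix v' w); first by rewrite gv !swapr.
rewrite /swap (negPf Nu) (negPf Nv) !ifF ?gK //.
  by apply/negP=> /prefixP[s E]; move: Nv; rewrite -[w]gK E fv prefix_prefix.
by apply/negP=> /prefixP[s E]; move: Nu; rewrite -[w]gK E fu prefix_prefix.
Qed.

End Swap.

Lemma sub_in_count (T : eqType) (a b : pred T) (s : seq T) :
  {in s, forall x, a x -> b x} -> count a s <= count b s.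
Proof.
elim: s => //= x s IH ab; rewrite leq_add //.
  by case: (a x) (ab x (mem_head x s)) => // ->.
by apply: IH => y ys; apply: ab; rewrite inE ys orbT.
Qed.

(** * Leaves and carets of finite trees *)

Section Trees.
Variable n : nat.
Implicit Types (tau : seq (word n)) (x y w : word n).

Lemma mem_leaves tau x :
  (x \in leaves tau) = (x \in tau) && [forall i, rcons x i \notin tau].
Proof. by rewrite mem_undup mem_filter andbC negb_exists. Qed.

Lemma size_bounded tau : exists K, forall x, x \in tau -> size x < K.
Proof.
elim: tau => [|y tau [K IH]]; first by exists 0.
exists (maxn (size y).+1 K) => x; rewrite inE leq_max => /predU1P[->|/IH->].
  by rewrite leqnn.
by rewrite orbT.
Qed.

(** A node properly extending [x] forces, by prefix closure, a child of [x] into the tree, so [x] is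
    not a leaf. *)
Lemma leaves_antichain tau : is_tree tau -> antichain (leaves tau).
Proof.
move=> [_ [sub _]].
suff half x y : x \in leaves tau -> y \in leaves tau -> x != y -> ~~ prefix x y.
  by move=> x y xl yl xy; rewrite /incomparable !half // eq_sym.
rewrite !mem_leaves => /andP[_ /forallP xl] /andP[yt _]; apply: contraNN.
case/prefixP=> [[|i s] E]; first by rewrite E cats0.
by have := xl i; rewrite -(_ : take (size x).+1 y = rcons x i) ?sub // E -cat_rcons
  take_size_cat ?size_rcons.
Qed.

(** Take the longest prefix of [w] in the tree. It is proper, and if it had children, all of them
    would be nodes and one would be a longer prefix. *)
Lemma leaf_prefix tau w : is_tree tau -> (forall x, x \in tau -> size x < size w) ->
  exists2 x, x \in leaves tau & prefix x w.
Proof.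
move=> [t0 [sub alln]] big.
have ex : exists k, (k <= size w) && (take k w \in tau) by exists 0; rewrite take0.
have [|k /andP[_ kt] kmax] := ex_maxnP (m := size w) ex; first by move=> k /andP[].
exists (take k w); last exact: prefix_take.
have kw : k < size w by move: (big _ kt); rewrite size_take; case: (ltnP k) => //; rewrite ltnn.
rewrite mem_leaves kt; case/orP: (alln (take k w)) => // /forallP /=.
case: w {ex sub alln} big kmax kw kt => // a w big kmax kw kt all_t.
have := kmax k.+1; rewrite kw (take_nth a) // all_t => /(_ isT).
by rewrite ltnn.
Qed.

Lemma induced_leaf tau b x w : is_tree tau -> x \in leaves tau ->
  induced tau b (x ++ w) = Some (b x ++ w).
Proof.
move=> tt xl; rewrite /induced.
case E: [seq _ <- _ | _] => [|y s].
  have : x \in [seq a <- leaves tau | prefix a (x ++ w)].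
    by rewrite mem_filter prefix_prefix.
  by rewrite E.
have : y \in [seq a <- leaves tau | prefix a (x ++ w)] by rewrite E mem_head.
rewrite mem_filter => /andP[yx yl]; have [->|xy] := eqVneq x y.
  by rewrite drop_size_catl.
by rewrite incomparable_cat // (leaves_antichain tt) // eq_sym in yx.
Qed.

Definition children x := [seq rcons x i | i <- enum 'I_n].

Lemma childrenP x w : reflect (exists i, w = rcons x i) (w \in children x).
Proof.
apply: (iffP mapP) => [[i _ ->]|[i ->]]; exists i => //; exact: mem_enum.
Qed.

(** A longest node has a parent [x] all of whose children are nodes, and by maximality leaves;
    deleting them makes [x] a leaf. *)
Lemma tree_caret tau : is_tree tau -> perm_eq (leaves tau) [:: [::]] \/
  exists x R tau', [/\ is_tree tau', perm_eq (leaves tau) (children x ++ R)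
                     & perm_eq (leaves tau') (x :: R)].
Proof.
move=> [t0 [sub alln]].
have [K Kb] := size_bounded tau.
have [/hasP[y0 y0t y0n]|/hasPn triv] := boolP (has (fun y => y != [::]) tau); last first.
  left; apply: uniq_perm; rewrite ?undup_uniq // => x; rewrite mem_leaves inE.
  have -> : (x \in tau) = (x == [::]).
    by apply/idP/eqP => [/triv|-> //]; rewrite negbK => /eqP.
  case: eqP => //= ->; apply/forallP=> i; apply/negP => /triv.
  by rewrite negbK -size_eq0 size_rcons.
right.
have ex : exists k, has (fun y => (y != [::]) && (size y == k)) tau.
  by exists (size y0); apply/hasP; exists y0; rewrite // y0n /=.
have ub k : has (fun y => (y != [::]) && (size y == k)) tau -> k <= K.
  by case/hasP=> y /Kb yK /andP[_ /eqP <-]; apply: ltnW.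
have [k /hasP[y yt /andP[yn /eqP ky]] kmax] := ex_maxnP ex ub.
have ymax z : z \in tau -> size z <= size y.
  move=> zt; case: (eqVneq z [::]) => [->//|zn]; rewrite ky; apply: kmax.
  by apply/hasP; exists z; rewrite // zn /=.
case/lastP: y => // x i in yt yn ky ymax *.
rewrite size_rcons in ymax.
have ct j : rcons x j \in tau.
  by case/orP: (alln x) => /forallP/(_ _)/= H //; rewrite (negPf (H i)) in yt.
have cl j : rcons x j \in leaves tau.
  rewrite mem_leaves ct; apply/forallP=> a; apply/negP => /ymax.
  by rewrite !size_rcons ltnn.
pose tau' := [seq w <- tau | w \notin children x].
have xt : x \in tau by have := sub _ (size x) yt; rewrite -cats1 take_size_cat.
have sub' z j : rcons z j \in tau' = (z != x) && (rcons z j \in tau).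
  rewrite mem_filter; congr (~~ _ && _); apply/childrenP/eqP => [[a /rcons_inj[]]|->] //.
  by exists j.
exists x, [seq w <- leaves tau | w \notin children x], tau'; split.
- split; first by rewrite mem_filter t0 andbT; apply/childrenP => -[j /(congr1 size)];
    rewrite size_rcons.
  split=> [w k0|w].
    rewrite !mem_filter => /andP[wc wt]; rewrite sub // andbT.
    apply: contra wc => /childrenP[j E].
    have : size (take k0 w) = (size x).+1 by rewrite E size_rcons.
    rewrite size_take; case: ltnP => [lt sk|ge sw].
      by have := ymax _ wt; rewrite -sk leqNgt lt.
    by rewrite -(take_oversize ge) E; apply/childrenP; exists j.
  under eq_forallb => j do rewrite sub'.
  under [X in _ || X]eq_forallb => j do rewrite sub'.
  by case: (w == x) => //=; apply/orP; right; apply/forallP.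
- apply: uniq_perm; rewrite ?undup_uniq //.
    rewrite cat_uniq (map_inj_uniq (@rcons_injr _ x)) enum_uniq filter_uniq ?undup_uniq //.
    by rewrite andbT; apply/hasPn => w; rewrite mem_filter => /andP[].
  move=> w; rewrite mem_cat mem_filter; case: childrenP => //= -[j ->].
  by rewrite cl.
apply: uniq_perm; rewrite ?undup_uniq //=.
  rewrite filter_uniq ?undup_uniq // andbT mem_filter mem_leaves xt /=.
  by rewrite negb_and negb_forall; apply/orP; right; apply/existsP; exists i; rewrite negbK ct.
move=> w; rewrite inE mem_filter !mem_leaves mem_filter.
under eq_forallb => j do rewrite sub' negb_and negbK.
have [->|wx] := eqVneq w x => /=.
  rewrite xt andbT; apply/andP; split; last by apply/forallP.
  by apply/childrenP=> -[j /(congr1 size)]; rewrite size_rcons; lia.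
by rewrite -andbA.
Qed.

End Trees.

(** * Two-letter words and the four generators *)

Section Generators.
Variable m : nat.
Local Notation n := m.+2.
Local Notation W := (word n).
Implicit Types (u v w x y z : W).

Definition pairs : seq W := [seq [:: i; j] | i <- enum 'I_n, j <- enum 'I_n].
Local Notation X := (nth ([::] : W) pairs).

Lemma size_pairs : size pairs = n * n.
Proof. by rewrite size_allpairs size_enum_ord. Qed.

Lemma mem_pairs w : (w \in pairs) = (size w == 2).
Proof.
apply/allpairsP/eqP=> [[[i j] [_ _ ->]] //|].
case: w => [|i [|j []]] // _; exists (i, j); split; rewrite ?mem_enum //.
Qed.

Lemma uniq_pairs : uniq pairs.
Proof.
apply: allpairs_uniq; rewrite ?enum_uniq //.
by move=> [a b] [c d] _ _ /= [-> ->].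
Qed.

Lemma size_X k : k < n * n -> size (X k) = 2.
Proof. by move=> kN; apply/eqP; rewrite -mem_pairs mem_nth // size_pairs. Qed.

Lemma pairsP u : size u = 2 -> exists2 k, k < n * n & u = X k.
Proof.
move=> su; have: u \in pairs by rewrite mem_pairs su.
by move=> uX; exists (index u pairs); rewrite -?size_pairs ?index_mem ?nth_index.
Qed.

Lemma X_incomparable j k : j < n * n -> k < n * n -> j != k -> incomparable (X j) (X k).
Proof.
move=> jN kN jk; apply: incomparable_size; first by rewrite !size_X.
by rewrite nth_uniq ?size_pairs ?uniq_pairs.
Qed.

(** [f] acts on positions in [pairs]. Words too short to have a two-letter prefix are fixed, so an
    involution of the positions gives an involution of all words. *)
Definition relabel (f : nat -> nat) w : W :=
  if size w < 2 then w else X (f (index (take 2 w) pairs)) ++ drop 2 w.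

Lemma relabelX f k w : k < n * n -> relabel f (X k ++ w) = X (f k) ++ w.
Proof.
move=> kN; rewrite /relabel size_cat size_X //=.
by rewrite take_size_cat ?size_X // drop_size_cat ?size_X // index_uniq ?size_pairs ?uniq_pairs.
Qed.

Lemma pair_prefixP w : 2 <= size w -> exists k w', k < n * n /\ w = X k ++ w'.
Proof.
move=> sw; have [k kN E] := @pairsP (take 2 w) (size_takel sw).
by exists k, (drop 2 w); rewrite -E cat_take_drop.
Qed.

Lemma relabelK f : (forall k, k < n * n -> f k < n * n) ->
  (forall k, k < n * n -> f (f k) = k) -> involutive (relabel f).
Proof.
move=> fN fK w; case: (ltnP (size w) 2) => [sw|/pair_prefixP[k [w' [kN ->]]]].
  by rewrite /relabel sw sw.
by rewrite !relabelX ?fK ?fN.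
Qed.

Inductive generator := GenA | GenB | GenT | GenD.

Definition low : W := [:: ord0; ord0].
Definition top : W := [:: ord_max].

(* [GenA] and [GenB] induce two reflections of the cycle on the list [pairs] of
   all two-letter words; their product is the rotation. *)
Definition gen (e : generator) : W -> W :=
  match e with
  | GenA => relabel (fun k => n * n - 1 - k)
  | GenB => relabel (fun k => (n * n - k) %% (n * n))
  | GenT => swap (X 0) (X 1)
  | GenD => swap low top
  end.

Lemma low_top : incomparable low top. Proof. by []. Qed.
Lemma pairs_ge4 : 4 <= n * n. Proof. by rewrite -[4]/(2 * 2) leq_mul. Qed.

Lemma X01 : incomparable (X 0) (X 1).
Proof. by apply: X_incomparable => //; have := pairs_ge4; lia. Qed.

Lemma genK e : involutive (gen e).
Proof.
have N4 := pairs_ge4.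
case: e => /=; [apply: relabelK|apply: relabelK|exact: swapK X01|exact: swapK low_top].
- by move=> k; lia.
- by move=> k; lia.
- by move=> k _; apply: ltn_pmod; lia.
(* Position 0 is the one where the modulus in [GenB] matters: [n * n - 0] wraps back to 0. *)
move=> k kN; have [->|k0] := posnP k; first by rewrite subn0 modnn subn0 modnn.
by rewrite (@modn_small (_ - k)) ?modn_small; lia.
Qed.

Definition act (s : seq generator) w : W := foldr gen w s.

Lemma act_cat s t w : act (s ++ t) w = act s (act t w).
Proof. by rewrite /act foldr_cat. Qed.

Lemma act_revK s : cancel (act (rev s)) (act s).
Proof.
by elim: s => // e s IH w; rewrite rev_cons -cats1 act_cat /= IH genK.
Qed.

Lemma actK s : cancel (act s) (act (rev s)).
Proof. by have := act_revK (rev s); rewrite revK. Qed.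

(** * Swaps that are products of the generators *)

Definition swap_gen u v := exists s, forall w, swap u v w = act s w.

Lemma swap_gen_conj s u v u' v' : swap_gen u v ->
  (forall w, act s (u ++ w) = u' ++ w) -> (forall w, act s (v ++ w) = v' ++ w) ->
  incomparable u v -> incomparable u' v' -> swap_gen u' v'.
Proof.
move=> [t tE] su sv uv uv'; exists (s ++ t ++ rev s) => w.
by rewrite (swap_conj (@act_revK s) su sv (@actK s)) // tE !act_cat.
Qed.

Lemma swap_gen_sym u v : incomparable u v -> swap_gen u v -> swap_gen v u.
Proof.
move=> uv [s sE]; exists s => w; rewrite -sE /swap.
case: ifP => // vw; case: ifP => // uw.
by have := prefix_comparable uw vw; case/andP: uv => /negPf-> /negPf->.
Qed.

(** Conjugating (u v) by (v w) fixes the cone at [u] and moves that at [v] to [w]. *)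
Lemma swap_gen_trans v u w : incomparable u v -> incomparable v w -> incomparable u w ->
  swap_gen u v -> swap_gen v w -> swap_gen u w.
Proof.
move=> uv vw uw Puv [s sE]; apply: (swap_gen_conj (s := s) Puv) => // x.
  by rewrite -sE swap_out // 1?incomparable_sym.
by rewrite -sE swapl.
Qed.

Lemma swap_genXS k : k.+1 < n * n -> swap_gen (X k) (X k.+1).
Proof.
have N4 := pairs_ge4.
elim: k => [_|k IH kN]; first by exists [:: GenT].
(* [GenA] acts first and sends j to [n * n - 1 - j], which [GenB] sends to [j.+1]; the bound
   excludes wrapping around. *)
have rot j w : j.+1 < n * n -> act [:: GenB; GenA] (X j ++ w) = X j.+1 ++ w.
  by move=> jN; rewrite /= !relabelX ?modn_small; try lia; congr (X _ ++ _); lia.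
apply: (swap_gen_conj (s := [:: GenB; GenA]) (IH _)).
- lia.
- by move=> w; rewrite rot //; lia.
- by move=> w; rewrite rot.
- by apply: X_incomparable; lia.
by apply: X_incomparable; lia.
Qed.

Lemma swap_genX j k : j < n * n -> k < n * n -> j != k -> swap_gen (X j) (X k).
Proof.
have lt i d : i + d.+1 < n * n -> swap_gen (X i) (X (i + d.+1)).
  elim: d => [|d IH] dN; first by rewrite addn1; apply: swap_genXS; lia.
  apply: (@swap_gen_trans (X (i + d.+1))); try (apply: X_incomparable; lia).
    by apply: IH; lia.
  by rewrite (addnS i d.+1); apply: swap_genXS; lia.
move=> jN kN jk; case: (ltngtP j k) jk => // [jk|kj] _.
  by have := lt j (k - j).-1; rewrite (_ : j + _ = k); [apply|]; lia.
apply: swap_gen_sym; first by apply: X_incomparable; lia.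
by have := lt k (j - k).-1; rewrite (_ : k + _ = j); [apply|]; lia.
Qed.

Lemma swap_gen_pairs u v : size u = 2 -> size v = 2 -> u != v -> swap_gen u v.
Proof.
move=> /pairsP[j jN ->] /pairsP[k kN ->] jk; apply: swap_genX => //.
by apply: contraNneq jk => ->.
Qed.

(** Of three distinct two-letter words, [u] and [v] exclude at most two. *)
Lemma fresh_pair u v : exists z : W, [/\ size z = 2, z != u & z != v].
Proof.
have [z [t [r [sz st sr [zt zr tr]]]]] : exists z t r : W,
  [/\ size z = 2, size t = 2, size r = 2 & [/\ z != t, z != r & t != r]].
  by exists [:: ord0; ord0], [:: ord0; ord_max], [:: ord_max; ord0]; split; split.
have [Ez|Nz] := boolP ((z != u) && (z != v)); first by exists z; case/andP: Ez.
have [Et|Nt] := boolP ((t != u) && (t != v)); first by exists t; case/andP: Et.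
exists r; split=> //; apply/eqP=> E; subst r; move: Nz Nt.
  by rewrite zr tr !negbK => /eqP zv /eqP tv; move: zt; rewrite zv tv eqxx.
by rewrite zr tr !andbT !negbK => /eqP zv /eqP tv; move: zt; rewrite zv tv eqxx.
Qed.

Lemma incomparable_pairs u v w x : size u = 2 -> size v = 2 -> u != v -> incomparable (u ++ w) (v ++ x).
Proof. by move=> su sv uv; rewrite incomparable_catlr // incomparable_size // su. Qed.

(** Conjugation by (u u'), which fixes the cone at [v] since [v] differs from both. *)
Lemma swap_gen_changel u u' v w : size u = 2 -> size u' = 2 -> size v = 2 ->
  v != u -> v != u' -> swap_gen (u ++ w) v -> swap_gen (u' ++ w) v.
Proof.
move=> su su' sv vu vu' P; have [<- //|uu'] := eqVneq u u'.
have iuv : incomparable u v by rewrite incomparable_size ?su // eq_sym.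
have iuv' : incomparable u' v by rewrite incomparable_size ?su' // eq_sym.
have [s sE] := swap_gen_pairs su su' uu'.
apply: (swap_gen_conj (s := s) P).
- by move=> x; rewrite -sE -!catA swapl.
- by move=> x; rewrite -sE swap_out.
- by rewrite -[v]cats0 incomparable_catlr.
by rewrite -[v]cats0 incomparable_catlr.
Qed.

Lemma swap_gen_changer u v v' w : size u = 2 -> size v' = 2 -> size v = 2 ->
  v != u -> v' != u -> swap_gen (u ++ w) v -> swap_gen (u ++ w) v'.
Proof.
move=> su sv' sv vu vu' P; have [<- //|vv'] := eqVneq v v'.
apply: (swap_gen_trans (v := v)) => //.
- by rewrite -[v]cats0 incomparable_pairs // eq_sym.
- by rewrite incomparable_size // sv.
- by rewrite -[v']cats0 incomparable_pairs // eq_sym.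
exact: swap_gen_pairs.
Qed.

Lemma swap_gen_child u v (i : 'I_n) : size u = 2 -> size v = 2 -> u != v -> swap_gen (rcons u i) v.
Proof.
move=> su sv uv.
(* [GenD] carries the cone at [ord_max; i] to the cone at [ord0; ord0; i]. *)
have base : swap_gen (low ++ [:: i]) [:: ord0; ord_max].
  have P : swap_gen [:: ord_max; i] [:: ord0; ord_max] by apply: swap_gen_pairs.
  apply: (swap_gen_conj (s := [:: GenD]) P) => // w.
  by rewrite /= -[[:: _, _ & _]]/(top ++ i :: w) swapr.
rewrite -cats1.
have to s : size s = 2 -> s != low -> swap_gen (low ++ [:: i]) s.
  by move=> ss sl; apply: (swap_gen_changer (v := [:: ord0; ord_max])) => //.
(* Replacing [low] by [u] needs a second word distinct from both, and [v] may equal [low]; hence the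
   detour through [z]. *)
have [z [sz zu zl]] := fresh_pair u low.
apply: (swap_gen_changer (v := z)) => //; first by rewrite eq_sym.
by apply: (swap_gen_changel (u := low)) => //; apply: to.
Qed.

Lemma swap_gen_deep u v w : size u = 2 -> size v = 2 -> u != v -> swap_gen (u ++ w) v.
Proof.
elim/last_ind: w u v => [|w i IH] u v su sv uv; first by rewrite cats0; apply: swap_gen_pairs.
(* The conjugating swap (uw z) must fix the cone at [v], so [z] avoids [v] too. *)
have [z [sz zu zv]] := fresh_pair u v.
have [s sE] : swap_gen (u ++ w) z by apply: IH => //; rewrite eq_sym.
have uz : incomparable (u ++ w) z by rewrite -[z]cats0 incomparable_pairs // eq_sym.
apply: (swap_gen_conj (s := s) (swap_gen_child i sz sv zv)) => [x|x||].
- by rewrite -sE cat_rcons swapr // -!catA cat_rcons.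
- rewrite -sE swap_out //; last by rewrite incomparable_size ?sz.
  by rewrite -[v]cats0 incomparable_pairs.
- by rewrite -cats1 -[v]cats0 incomparable_pairs.
by rewrite -[v]cats0 incomparable_pairs.
Qed.

(** A two-letter word [z] that begins neither [u] nor [v] links them: (u z) and (z v) are known,
    even when [u] and [v] share their first two letters. *)
Lemma swap_gen_incomparable u v :
  2 <= size u -> 2 <= size v -> incomparable u v -> swap_gen u v.
Proof.
move=> su sv uv; have [sx sy] := (size_takel su, size_takel sv).
have [z [sz zx zy]] := fresh_pair (take 2 u) (take 2 v).
have xu := cat_take_drop 2 u; have yv := cat_take_drop 2 v.
have uz : incomparable u z by rewrite -xu -[z]cats0 incomparable_pairs // eq_sym.
have vz : incomparable v z by rewrite -yv -[z]cats0 incomparable_pairs // eq_sym.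
apply: (swap_gen_trans (v := z)) => //; first by rewrite incomparable_sym.
  by rewrite -xu; apply: swap_gen_deep => //; rewrite eq_sym.
by apply: swap_gen_sym => //; rewrite -yv; apply: swap_gen_deep => //; rewrite eq_sym.
Qed.

(** * Transport of cones between leaves of trees *)

(* Only proper extensions of [u] are constrained: a swap of cones at short words
   is reached as the product of the swaps of their children, which fixes the
   roots of these cones. *)
Definition maps_cone s u v := forall a w, act s (u ++ a :: w) = v ++ a :: w.

Lemma maps_cone_cat s t u v x : maps_cone t u v -> maps_cone s v x -> maps_cone (s ++ t) u x.
Proof. by move=> tu su a w; rewrite act_cat tu su. Qed.

Lemma maps_cone_ext s u v x : maps_cone s u v -> maps_cone s (u ++ x) (v ++ x).
Proof.
move=> su a w; rewrite -!catA; case: x => [|b x]; first exact: su.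
exact: su.
Qed.

Lemma swap_maps_cone u v : incomparable u v ->
  exists s, forall z, [|| z == u, z == v | incomparable u z && incomparable v z] ->
    maps_cone s z (swap u v z).
Proof.
move=> uv.
(* Incomparable words are nonempty, so their children have length at least two and can be swapped by
   [swap_gen_incomparable]. *)
have szu x y : incomparable x y -> 0 < size x by case: x => // /andP[]; rewrite prefix0s.
have su := szu _ _ uv; have sv := szu v u; rewrite incomparable_sym uv in sv.
have {}sv := sv isT.
have [s [s1 s2 s3]] : exists s, [/\
    forall i w, act s (rcons u i ++ w) = rcons (if i \in enum 'I_n then v else u) i ++ w,
    forall i w, act s (rcons v i ++ w) = rcons (if i \in enum 'I_n then u else v) i ++ w &
    forall z w, incomparable u z -> incomparable v z -> act s (z ++ w) = z ++ w].
  (* Induction on a list of letters: the children at listed letters are exchanged, the others stay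
     in place. *)
  elim: (enum 'I_n) (enum_uniq 'I_n) => [|j l IH] /=; first by exists [::].
  case/andP=> jl /IH[s [s1 s2 s3]].
  have jv := incomparable_rcons j j uv.
  have [t tE] : swap_gen (rcons u j) (rcons v j).
    by apply: swap_gen_incomparable; rewrite ?size_rcons.
  have sib x i : i != j -> incomparable (rcons x j) (rcons x i).
    by move=> ij; rewrite incomparable_size ?size_rcons // eqseq_rcons eqxx eq_sym.
  exists (t ++ s); split=> [i w|i w|z w uz vz]; rewrite act_cat -tE.
  - rewrite s1 inE; have [->|ij] := eqVneq i j; first by rewrite (negPf jl) swapl.
    case: ifP => _; rewrite swap_out //; try exact: sib.
      exact: incomparable_rcons.
    by rewrite incomparable_rcons // incomparable_sym.
  - rewrite s2 inE; have [->|ij] := eqVneq i j; first by rewrite (negPf jl) swapr.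
    case: ifP => _; rewrite swap_out //; try exact: sib.
      by rewrite incomparable_rcons // incomparable_sym.
    exact: incomparable_rcons.
  by rewrite s3 // swap_out // -cats1 -[z]cats0 incomparable_catlr.
exists s => z /or3P[/eqP->|/eqP->|/andP[uz vz]] a w.
- by rewrite -cat_rcons s1 mem_enum swap_left cat_rcons.
- by rewrite -cat_rcons s2 mem_enum swap_right // cat_rcons.
by rewrite s3 // swap_fix.
Qed.

Lemma swap_antichain C u v : antichain C -> u \in C -> v \in C -> uniq C ->
  (exists s, forall z, z \in C -> maps_cone s z (swap u v z)) /\
  perm_eq (map (swap u v) C) C.
Proof.
move=> aC uC vC uqC; have [->|/(aC _ _ uC vC) uv] := eqVneq u v.
  split; first by exists [::] => z _ a w; rewrite swapxx.
  by rewrite (eq_map (swapxx v)) map_id.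
have alt z : z \in C -> [|| z == u, z == v | incomparable u z && incomparable v z].
  move=> zC; have [//|zu] := eqVneq z u; have [//|zv] := eqVneq z v.
  by rewrite !aC // eq_sym.
have mem z : z \in C -> swap u v z \in C.
  move=> zC; case/or3P: (alt z zC) => [/eqP->|/eqP->|/andP[uz vz]].
  - by rewrite swap_left.
  - by rewrite swap_right.
  by rewrite swap_fix.
split; first by have [s sz] := swap_maps_cone uv; exists s => z /alt /sz.
have inj := inv_inj (swapK uv).
apply: uniq_perm; rewrite ?map_inj_uniq // => z.
apply/mapP/idP => [[x xC ->]|zC]; first exact: mem.
by exists (swap u v z); rewrite ?swapK // mem.
Qed.

(** Induction on the number of moved points: composing [f] with the swap of a moved [x] and [f x]
    fixes [x] and keeps every fixed point of [f] fixed. *)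
Lemma perm_maps_cone C (f : W -> W) : antichain C -> uniq C -> perm_eq (map f C) C ->
  exists s, forall z, z \in C -> maps_cone s z (f z).
Proof.
move=> aC uC; have [k] := ubnP (count (fun z => f z != z) C).
elim: k f => // k IH f; rewrite ltnS => le pf.
have [/hasP[x xC fx]|/hasPn fix_f] := boolP (has (fun z => f z != z) C); last first.
  by exists [::] => z /fix_f; rewrite negbK => /eqP->.
have mem z : z \in C -> f z \in C by move=> zC; rewrite -(perm_mem pf) map_f.
have inj : {in C &, injective f}.
  move=> y z yC zC E; apply/eqP; rewrite -[y == z]negbK; apply/negP=> yz.
  have: uniq (map f C) by rewrite (perm_uniq pf).
  apply/negP/(uniqPn (f y)); have [iy iz] : index y C < size C /\ index z C < size C by rewrite !index_mem.
  have : index y C != index z C by apply: contra yz => /eqP E'; rewrite -(nth_index y yC) E' nth_index.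
  rewrite neq_ltn size_map => /orP[lt|lt].
    by exists (index y C), (index z C); rewrite !(nth_map y) // !nth_index.
  by exists (index z C), (index y C); rewrite !(nth_map y) // !nth_index.
have xfx : incomparable x (f x) by apply: aC; rewrite ?mem // eq_sym.
have [[s sz] ps] := swap_antichain aC xC (mem x xC) uC.
have [||t tz] := IH (fun z => swap x (f x) (f z)).
- apply: leq_trans le; rewrite !(permP (perm_to_rem xC)) /= fx swap_right // eqxx ltnS.
  apply: sub_in_count => z; rewrite mem_rem_uniq // => /andP[/= zx zC].
  apply: contraNneq => fz; rewrite fz swap_fix //; first by apply: aC; rewrite // eq_sym.
  apply: aC; rewrite ?mem //; apply: contraNneq zx => fxz.
  by apply/eqP/inj; rewrite // fz.
- by rewrite -[map _ _]/(map (swap x (f x) \o f) C) map_comp (perm_trans (perm_map _ pf)).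
exists (s ++ t) => z zC; apply: maps_cone_cat (tz z zC) _.
have := sz (swap x (f x) (f z)); rewrite swapK //.
by apply; rewrite -(perm_mem ps) map_f ?mem.
Qed.

(** Induction on the number of leaves, removing one caret from each tree. Only some bijection of the
    leaves is produced; a prescribed one is reached afterwards by permuting the leaves of [tau1]. *)
Lemma transport_leaves (tau0 tau1 : seq W) : is_tree tau0 -> is_tree tau1 ->
  size (leaves tau0) = size (leaves tau1) ->
  exists s f, perm_eq (map f (leaves tau0)) (leaves tau1) /\
    forall x, x \in leaves tau0 -> maps_cone s x (f x).
Proof.
have [k] := ubnP (size (leaves tau0)).
elim: k tau0 tau1 => // k IH tau0 tau1; rewrite ltnS => le t0 t1 szE.
have szc x : size (children x) = n by rewrite size_map size_enum_ord.
case: (tree_caret t0) (tree_caret t1) => [p0|[x [R [tau0' [t0' p0 p0']]]]].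
  case=> [p1|[y [S [tau1' [t1' p1 p1']]]]].
    exists [::], id; split=> [|x _ a w //].
    by rewrite map_id (perm_trans p0) // perm_sym.
  (* A tree with a caret has at least n leaves, and n is at least two, so it cannot match the
     one-leaf tree. *)
  move: szE; rewrite (perm_size p0) (perm_size p1) size_cat szc /=; lia.
case=> [p1|[y [S [tau1' [t1' p1 p1']]]]].
  by move: szE; rewrite (perm_size p0) (perm_size p1) size_cat szc /=; lia.
have [||s [f [pf sf]]] := IH _ _ _ t0' t1'.
- by move: le; rewrite (perm_size p0) (perm_size p0') size_cat szc /=; lia.
- move: szE; rewrite (perm_size p0) (perm_size p0') (perm_size p1) (perm_size p1').
  by rewrite !size_cat !szc /=; lia.
have memx : x \in leaves tau0' by rewrite (perm_mem p0') mem_head.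
have memy : y \in leaves tau1' by rewrite (perm_mem p1') mem_head.
have memf z : z \in leaves tau0' -> f z \in leaves tau1'.
  by move=> zl; rewrite -(perm_mem pf) map_f.
have [[t tS] pS] := swap_antichain (leaves_antichain t1') (memf x memx) memy (undup_uniq _).
(* The transport of the reduced trees is corrected to send [x] to [y]; it then sends the children of
   [x] to the corresponding children of [y]. *)
pose g w := swap (f x) y (f w).
have gx : g x = y by rewrite /g swap_left.
have gz z : z \in leaves tau0' -> maps_cone (t ++ s) z (g z).
  by move=> zl; apply: maps_cone_cat (sf z zl) (tS _ (memf z zl)).
have pg : perm_eq (map g R) S.
  rewrite -(perm_cons y) -{1}gx -[_ :: map g R]/(map g (x :: R)).
  apply: perm_trans p1'; apply: perm_trans pS.
  rewrite perm_sym (map_comp _ f); apply: perm_map.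
  by rewrite perm_sym; apply: perm_trans pf; apply: perm_map; rewrite perm_sym.
have Rx z : z \in R -> prefix x z = false.
  move=> zR; have zl : z \in leaves tau0' by rewrite (perm_mem p0') inE zR orbT.
  have: uniq (x :: R) by rewrite -(perm_uniq p0') undup_uniq.
  case/andP=> xR _; have xz : x != z by apply: contraNneq xR => ->.
  by have /andP[/negPf] := leaves_antichain t0' memx zl xz.
exists (t ++ s), (fun w => if prefix x w then y ++ drop (size x) w else g w).
have ch i : rcons x i = x ++ [:: i] by rewrite cats1.
split.
  apply: perm_trans (perm_map _ p0) _; rewrite perm_sym; apply: perm_trans p1 _.
  rewrite map_cat -map_comp perm_sym; apply: perm_cat.
    rewrite (_ : map _ _ = children y) //; apply: eq_map => i /=.
    by rewrite prefix_rcons ch drop_size_catl cats1.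
  by rewrite (_ : map _ R = map g R) //; apply/eq_in_map => z /Rx ->.
move=> z; rewrite (perm_mem p0) mem_cat => /orP[/childrenP[i ->]|zR].
  by rewrite prefix_rcons ch drop_size_catl; apply: maps_cone_ext; rewrite -gx; apply: gz.
by rewrite Rx //; apply: gz; rewrite (perm_mem p0') inE zR orbT.
Qed.

Lemma induced_act (tau0 tau1 : seq W) b : is_tree tau0 -> is_tree tau1 ->
  perm_eq (map b (leaves tau0)) (leaves tau1) ->
  exists s K, forall w, K <= size w -> induced tau0 b w = Some (act s w).
Proof.
move=> t0 t1 pb.
have [|s [f [pf sf]]] := transport_leaves t0 t1; first by rewrite -(perm_size pb) size_map.
(* [h] is b composed with the inverse of [f], a permutation of the leaves of [tau1]; the default of
   [nth] is not reached on images of leaves. *)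
pose h w := b (nth [::] (leaves tau0) (index w (map f (leaves tau0)))).
have uf : uniq (map f (leaves tau0)) by rewrite (perm_uniq pf) undup_uniq.
have hf x : x \in leaves tau0 -> h (f x) = b x.
  move=> xl; rewrite /h; congr b.
  rewrite -[in f x](nth_index [::] xl) -(nth_map [::] [::]) ?index_mem //.
  by rewrite index_uniq ?size_map ?index_mem ?nth_index.
have [|t th] := perm_maps_cone (f := h) (leaves_antichain t1) (undup_uniq _).
  apply: perm_trans (perm_map _ _) _; first by rewrite perm_sym; exact: pf.
  rewrite -map_comp (_ : map _ _ = map b (leaves tau0)) //.
  by apply/eq_in_map => x /hf.
have [K Kb] := size_bounded tau0.
(* Words longer than [K] properly extend their leaf, as [maps_cone] demands. *)
exists (t ++ s), K.+1 => w Kw.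
have [x xl /prefixP[r wE]] : exists2 x, x \in leaves tau0 & prefix x w.
  by apply: leaf_prefix => // x /Kb; lia.
have xK : size x < K by apply: Kb; move: xl; rewrite mem_leaves => /andP[].
rewrite wE induced_leaf //; congr Some; case: r wE => [wE|a r _].
  by move: Kw; rewrite wE cats0 => /(ltn_trans xK); rewrite ltnn.
by rewrite (maps_cone_cat (sf x xl) (th (f x) _)) ?hf // -(perm_mem pf) map_f.
Qed.

(** * The generators as involutions in the group *)

Definition letters : seq W := [seq [:: i] | i <- enum 'I_n].

(** [low] and [top] must both be leaves for [GenD], so only the letter [ord0] is expanded there; the
    other generators permute all two-letter words and use the full tree of depth two. *)
Definition generator_tree (e : generator) : seq W :=
  [::] :: letters ++
    (if e is GenD then [seq [:: ord0; i] | i <- enum 'I_n] else pairs).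

Lemma mem_generator_tree e w : w \in generator_tree e =
  (size w < 2) || (size w == 2) && (if e is GenD then head ord0 w == ord0 else true).
Proof.
rewrite inE mem_cat; case: w => [|i [|j w]] //=.
  by rewrite map_f ?mem_enum ?orbT.
have -> : ([:: i, j & w] \in letters) = false by apply/negP=> /mapP[].
case: e; rewrite /= ?mem_pairs ?andbT //.
apply/mapP/andP => [[k _ [-> _ ->]] //|[]].
by case: w => //= _ /eqP->; exists j; rewrite // mem_enum.
Qed.

Lemma forallb_const (c : bool) : [forall i : 'I_n, c] = c.
Proof. by apply/forallP/idP => [/(_ ord0)|]. Qed.

Lemma generator_treeP e : is_tree (generator_tree e).
Proof.
split; first by rewrite mem_head.
split=> [w k|w].
  rewrite !mem_generator_tree size_take.
  by case: w k => [|i [|j [|l w]]] [|[|[|k]]] //=; case: e.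
have E i : rcons w i \in generator_tree e =
    (size w == 0) || (size w == 1) && (if e is GenD then head ord0 w == ord0 else true).
  by rewrite mem_generator_tree size_rcons !ltnS leqn0 eqSS; case: w => [|j [|]].
by rewrite (eq_forallb E) (eq_forallb (fun i => congr1 negb (E i))) !forallb_const orbN.
Qed.

Lemma mem_generator_leaves e w : w \in leaves (generator_tree e) =
  if e is GenD then (size w == 1) && (head ord0 w != ord0) || (size w == 2) && (head ord0 w == ord0)
  else size w == 2.
Proof.
rewrite mem_leaves mem_generator_tree.
have E i : rcons w i \notin generator_tree e =
    ~~ ((size w == 0) || (size w == 1) && (if e is GenD then head ord0 w == ord0 else true)).
  by rewrite mem_generator_tree size_rcons !ltnS leqn0 eqSS; case: w => [|j [|]].
rewrite (eq_forallb E) forallb_const.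
by case: e {E}; case: w => [|i [|j [|k w]]] //=; rewrite ?andbT ?andbF ?orbF.
Qed.

Lemma antichain_swap_cat (C : seq W) u v x w : antichain C ->
  u \in C -> v \in C -> x \in C -> swap u v (x ++ w) = swap u v x ++ w.
Proof.
move=> aC uC vC xC; have [->|uv] := eqVneq u v; first by rewrite !swapxx.
have [->|xu] := eqVneq x u; first by rewrite swapl swap_left.
have [->|xv] := eqVneq x v; first by rewrite swapr ?swap_right ?aC.
by rewrite swap_out ?swap_fix ?aC // eq_sym.
Qed.

Lemma X01_leaves : X 0 \in leaves (generator_tree GenT) /\ X 1 \in leaves (generator_tree GenT).
Proof. by have := pairs_ge4; rewrite !mem_generator_leaves => N4; rewrite !size_X; lia. Qed.

Lemma low_top_leaves : low \in leaves (generator_tree GenD) /\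
  top \in leaves (generator_tree GenD).
Proof. by rewrite !mem_generator_leaves. Qed.

Lemma gen_leaf_cat e x w : x \in leaves (generator_tree e) -> gen e (x ++ w) = gen e x ++ w.
Proof.
have anti e' := leaves_antichain (generator_treeP e').
case: e => xl.
- move: xl; rewrite mem_generator_leaves => /eqP/pairsP[k kN ->] /=.
  by rewrite -{2}[X k]cats0 !relabelX // cats0.
- move: xl; rewrite mem_generator_leaves => /eqP/pairsP[k kN ->] /=.
  by rewrite -{2}[X k]cats0 !relabelX // cats0.
- by have [? ?] := X01_leaves; apply: antichain_swap_cat (anti GenT) _ _ _.
by have [? ?] := low_top_leaves; apply: antichain_swap_cat (anti GenD) _ _ _.
Qed.

Lemma size_relabel f w : (forall k, k < n * n -> f k < n * n) -> size (relabel f w) = size w.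
Proof.
move=> fN; case: (ltnP (size w) 2) => [sw|/pair_prefixP[k [w' [kN ->]]]].
  by rewrite /relabel sw.
by rewrite relabelX // !size_cat !size_X ?fN.
Qed.

Lemma gen_leaf e x : x \in leaves (generator_tree e) -> gen e x \in leaves (generator_tree e).
Proof.
have N4 := pairs_ge4; have anti e' := leaves_antichain (generator_treeP e').
case: e => xl.
- by move: xl; rewrite !mem_generator_leaves size_relabel // => k; lia.
- by move: xl; rewrite !mem_generator_leaves size_relabel // => k _; apply: ltn_pmod; lia.
- have [l0 l1] := X01_leaves; have [_ p] := swap_antichain (anti GenT) l0 l1 (undup_uniq _).
  by rewrite -(perm_mem p) map_f.
have [l0 l1] := low_top_leaves; have [_ p] := swap_antichain (anti GenD) l0 l1 (undup_uniq _).
by rewrite -(perm_mem p) map_f.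
Qed.

Lemma gen_leaf_moved e : exists2 x, x \in leaves (generator_tree e) & gen e x != x.
Proof.
have N4 := pairs_ge4.
have Xneq j k : j < n * n -> k < n * n -> j != k -> X j != X k.
  by move=> jN kN jk; apply/incomparable_neq/X_incomparable.
case: e.
- exists (X 0); first by rewrite mem_generator_leaves size_X //; lia.
  by rewrite -[X 0]cats0 /= relabelX ?cats0 ?Xneq; lia.
- exists (X 1); first by rewrite mem_generator_leaves size_X //; lia.
  by rewrite -[X 1]cats0 /= relabelX ?cats0 ?Xneq ?modn_small; lia.
- by exists (X 0); rewrite ?(X01_leaves.1) //= swap_left Xneq //; lia.
by exists low; rewrite ?(low_top_leaves.1) //= swap_left.
Qed.

(** Only [GenD] changes lengths, by one letter. The bound on the loss tells how long a word must be
    for a composite to be defined on it. *)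
Lemma size_gen e w : size w <= (size (gen e w)).+1.
Proof.
have N4 := pairs_ge4; case: e => /=.
- by rewrite size_relabel // => k; lia.
- by rewrite size_relabel // => k _; apply: ltn_pmod; lia.
- rewrite /swap; case: ifP => [/prefixP[s ->]|_]; last case: ifP => [/prefixP[s ->]|_ //].
    by rewrite drop_size_catl !size_cat !size_X; lia.
  by rewrite drop_size_catl !size_cat !size_X; lia.
rewrite /swap; case: ifP => [/prefixP[s ->]|_]; last case: ifP => [/prefixP[s ->]|_ //].
  by rewrite drop_size_catl !size_cat.
by rewrite drop_size_catl !size_cat /=; lia.
Qed.

Definition gen_fun e : W -> option W := induced (generator_tree e) (gen e).

Lemma gen_funE e w : 3 <= size w -> gen_fun e w = Some (gen e w).
Proof.
move=> sw; have [x xt|x xl /prefixP[r ->]] := leaf_prefix (w := w) (generator_treeP e).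
  by move: xt; rewrite mem_generator_tree; case: e; lia.
by rewrite /gen_fun (induced_leaf _ _ (generator_treeP e)) // gen_leaf_cat.
Qed.

Lemma short_words K : exists L : seq W, forall w, size w < K -> w \in L.
Proof.
elim: K => [|K [L LP]]; first by exists [::].
exists ([::] :: [seq i :: w | i <- enum 'I_n, w <- L]) => -[|i w] //= sw.
rewrite inE; apply/allpairsP; exists (i, w); split; rewrite ?mem_enum //=.
exact: LP.
Qed.

(** The alphabet is finite, so the words shorter than [K] form a finite exceptional set. *)
Lemma Veq_deep (f g : W -> option W) K :
  (forall w, K <= size w -> f w = g w) -> Veq f g.
Proof.
move=> fg; have [L LP] := short_words K; exists L => w wL.
by apply: fg; rewrite leqNgt; apply: contra wL; apply: LP.
Qed.

Lemma Vinvolution_gen e : Vinvolution (gen_fun e).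
Proof.
split; [|split].
- exists (generator_tree e), (generator_tree e), (gen e).
  split; [|split; [|split=> //]]; try exact: generator_treeP.
  apply: uniq_perm; rewrite ?map_inj_uniq ?undup_uniq //; try exact: inv_inj (genK e).
  move=> x; apply/mapP/idP => [[y yl ->]|xl]; first exact: gen_leaf.
  by exists (gen e x); rewrite ?genK // gen_leaf.
- case=> L; have [K Kb] := size_bounded L => LP.
  have [x xl /eqP xm] := gen_leaf_moved e; apply: xm.
  (* Padding a moved leaf with [K] letters escapes the exceptional list; cancelling the padding
     would show the leaf fixed. *)
  have xL : x ++ nseq K ord0 \notin L by apply/negP => /Kb; rewrite size_cat size_nseq; lia.
  have := LP _ xL; rewrite /gen_fun (induced_leaf _ _ (generator_treeP e)) // => -[E].
  have /eqP := congr1 size E; rewrite !size_cat eqn_add2r => sE.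
  by move/eqP: E; rewrite eqseq_cat ?(eqP sE) // => /andP[/eqP].
(* The second application needs three letters, and the first may lose one. *)
apply: (@Veq_deep _ _ 4) => w sw; rewrite /Vcomp gen_funE; last lia.
by rewrite /= gen_funE ?genK //; have := size_gen e w; lia.
Qed.

(** Each factor shortens the word by at most one letter, so at least three letters remain whenever
    the next factor is applied. *)
Lemma Vprod_gen s w : size s + 3 <= size w ->
  Vprod (map gen_fun s) w = Some (act s w) /\ size w <= size (act s w) + size s.
Proof.
elim: s => [|e s IH] /= sw; first by rewrite addn0.
have [|IH1 IH2] := IH; first by lia.
rewrite /Vcomp -/(Vprod _) IH1 /=; have := size_gen e (act s w).
by split; [rewrite gen_funE //|]; lia.
Qed.

End Generators.

(** * Generation of the whole group *)

Theorem theorem4p1 (n : nat) (hn : 2 <= n) :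
  exists a b c d : word n -> option (word n),
    [/\ Vinvolution a, Vinvolution b, Vinvolution c & Vinvolution d] /\
    forall g : word n -> option (word n), is_Vn g ->
      exists s : seq (word n -> option (word n)),
        all_among4 a b c d s /\
        Veq g (Vprod s).
Proof.
case: n hn => [|[|m]] // _.
exists (gen_fun GenA), (gen_fun GenB), (gen_fun GenT), (gen_fun GenD).
split=> [|g [tau0 [tau1 [b [t0 [t1 [pb gE]]]]]]]; first by split; apply: Vinvolution_gen.
have [s [K sE]] := induced_act t0 t1 pb.
exists (map (@gen_fun m) s); split.
  by elim: s {sE} => //= e s IH; split=> //; case: e; tauto.
(* The sum exceeds both thresholds: [K] for the element [g], and [size s + 3] for the product of
   generators. *)
apply: (@Veq_deep _ _ _ (K + (size s + 3))) => w sw; rewrite gE sE; last by lia.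
have ws : size s + 3 <= size w by lia.
by have [-> _] := Vprod_gen ws.
Qed.
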